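(* Let $L_{\mathsf T}$ be a bar word language (resp. bar $\omega$-language, bar tree language over a finite signature $\Sigma$) that is accepted, under bar language semantics, by some bar word automaton (resp. bar Büchi automaton, bar tree automaton) with finite alphabet $\overline{\mathbb A}_0\subseteq\overline{\mathbb A}$. Let $\mathsf L$ be an internal learner (an arbitrary MAT-based learner for regular word/$\omega$-/tree languages over $\overline{\mathbb A}_0$), and suppose that $\mathsf L$ needs $M(L_{\mathsf T}\restriction\overline{\mathbb A}_0)$ membership queries and $E(L_{\mathsf T}\restriction\overline{\mathbb A}_0)$ equivalence queries to learn a finite automaton (resp. Büchi automaton, tree automaton) for the regular language $L_{\mathsf T}\restriction\overline{\mathbb A}_0$. Then the learner $\mathsf L_{\mathsf{bar}}$ (built from $\mathsf L$ as described in the context) learns a bar automaton for $L_{\mathsf T}$, i.e. a bar automaton $\mathcal H$ with $L_\alpha(\mathcal H)=L_{\mathsf T}$, with at most $M(L_{\mathsf T}\restriction\overline{\mathbb A}_0)$ membership queries and at most $E(L_{\mathsf T}\restriction\overline{\mathbb A}_0)$ equivalence queries to the teacher for $L_{\mathsf T}$.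
   Context: **Names and bar inputs.** $\mathbb A$ is a fixed countably infinite set of names; $\overline{\mathbb A}=\mathbb A\cup\{\vert a : a\in\mathbb A\}$, where $a$ is a plain name and $\vert a$ a bar name. Finite permutations $\pi$ of $\mathbb A$ act by $\pi\cdot a=\pi(a)$, $\pi\cdot\vert a=\vert\pi(a)$, letterwise on words and nodewise on trees. $(a\ c)$ is the transposition of $a,c$. For objects $x,y$ (finite words over $\overline{\mathbb A}$, or bar trees) write $\langle a\rangle x=\langle b\rangle y$ iff $(a\ c)\cdot x=(b\ c)\cdot y$ for some (equivalently every) name $c\notin\{a,b\}$ that does not occur (plain or barred) in $x$ or $y$. Finite bar strings are elements of $\overline{\mathbb A}^*$; $\equiv_\alpha$ on them is the equivalence relation generated by $w\vert a\,v\equiv_\alpha w\vert b\,u$ whenever $\langle a\rangle v=\langle b\rangle u$. Infinite bar strings are elements of $\overline{\mathbb A}^\omega$; $v\equiv_\alpha w$ iff for every $n$ the length-$n$ prefixes are $\alpha$-equivalent. For a finite signature $\Sigma$, bar trees are finite trees over the signature with one $n$-ary symbol $\alpha.f$ for all $\alpha\in\overline{\mathbb A}$ and $n$-ary $f\in\Sigma$; $\equiv_\alpha$ is the least congruence with $\vert a.f(t_1,\dots,t_n)\equiv_\alpha\vert b.f(t_1',\dots,t_n')$ whenever $\langle a\rangle t_i=\langle b\rangle t_i'$ for all $i$. A bar word/$\omega$-/tree language is a set of finite bar strings/infinite bar strings/bar trees closed under $\equiv_\alpha$. A *bar input* is a finite bar string, an ultimately periodic bar string $uv^\omega$ (given by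 a pair $(u,v)$ of finite words, $v$ nonempty), or a bar tree, respectively. $L\restriction\overline{\mathbb A}_0$ is the set of elements of $L$ using only letters from $\overline{\mathbb A}_0$. **Bar automata.** A bar word automaton (DFA or NFA)/bar Büchi automaton/bar tree automaton (bottom-up DFTA or NFTA) with finite alphabet $\overline{\mathbb A}_0\subseteq\overline{\mathbb A}$ is an ordinary automaton of the respective type over the finite alphabet $\overline{\mathbb A}_0$ (in the tree case over the signature $\overline{\mathbb A}_0\times\Sigma$). $L(\mathcal A)$ is its usual accepted (literal) language and $L_\alpha(\mathcal A)$ is the closure of $L(\mathcal A)$ under $\equiv_\alpha$. **MAT learning.** In the minimally adequate teacher framework for an unknown regular language $L$ over a known finite alphabet, the learner may ask membership queries (is a given input in $L$? For $\omega$-languages inputs are ultimately periodic words given by pairs $(u,v)$) and equivalence queries (given a hypothesis automaton $\mathcal H$, is $L(\mathcal H)=L$? If not, the teacher returns an input in the symmetric difference $L(\mathcal H)\oplus L$, which is ultimately periodic in the $\omega$-case). $M(L)$ and $E(L)$ denote the numbers of membership and equivalence queries the learner needs to learn an automaton for $L$. For learning the bar language $L_{\mathsf T}$, the teacher $\mathsf T$ answers membership queries (is a given bar input in $L_{\mathsf T}$?) and equivalence queries (given a bar automaton $\mathcal H$, is $L_\alpha(\mathcal H)=L_{\mathsf T}$? If not, $\mathsf T$ returns a bar input $w_{\mathsf T}\in L_\alpha(\mathcal H)\oplus L_{\mathsf T}$, over the infinite alphabet $\overline{\mathbb A}$). **The learner $\mathsf L_{\mathsf{bar}}$.** It knows $\overline{\mathbb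 A}_0$ and runs the internal learner $\mathsf L$ over the alphabet $\overline{\mathbb A}_0$. Membership queries of $\mathsf L$ and their answers are relayed unchanged between $\mathsf L$ and $\mathsf T$. An equivalence query of $\mathsf L$ with hypothesis $\mathcal H$ (a bar automaton over $\overline{\mathbb A}_0$) is relayed to $\mathsf T$. If $\mathsf T$ answers that $L_\alpha(\mathcal H)=L_{\mathsf T}$, then $\mathsf L_{\mathsf{bar}}$ terminates with $\mathcal H$. Otherwise, given $w_{\mathsf T}$: (Step 1) compute a bar input $w$ over $\overline{\mathbb A}_0$ with $w\equiv_\alpha w_{\mathsf T}$; (Step 2) if there is a bar input $w'\equiv_\alpha w$ with $w'\in L(\mathcal H)$, return such a $w'$ to $\mathsf L$ as counterexample; otherwise return $w$ to $\mathsf L$ as counterexample. *)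

(* Defs.v *)
From HB Require Import structures.
From mathcomp Require Import all_boot finmap.
From Stdlib Require Import Relation_Operators.

Set Implicit Arguments.
Unset Strict Implicit.
Unset Printing Implicit Defensive.

Definition name : Type := nat.

Inductive letter : Type := Plain of name | Bar of name.

Definition letter_to_sum (l : letter) : nat + nat :=
  match l with Plain a => inl a | Bar a => inr a end.
Definition sum_to_letter (s : nat + nat) : letter :=
  match s with inl a => Plain a | inr a => Bar a end.
Lemma letter_to_sumK : cancel letter_to_sum sum_to_letter.
Proof. by case. Qed.
HB.instance Definition _ := Countable.copy letter (can_type letter_to_sumK).

Definition name_of (l : letter) : name :=
  match l with Plain a => a | Bar a => a end.

Definition ren_letter (p : name -> name) (l : letter) : letter :=
  match l with Plain a => Plain (p a) | Bar a => Bar (p a) end.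

Definition transp (a c : name) : name -> name :=
  fun n => if n == a then c else if n == c then a else n.

(* <a>x = <b>y, for any type X with a renaming action and an occurrence
   relation. *)
Definition abs_eq (X : Type) (ren : (name -> name) -> X -> X)
    (occurs : name -> X -> bool) (a : name) (x : X) (b : name) (y : X) : Prop :=
  exists c : name,
    [/\ c != a, c != b, ~~ occurs c x, ~~ occurs c y
      & ren (transp a c) x = ren (transp b c) y].

(** * Finite words *)

Definition ren_word (p : name -> name) : seq letter -> seq letter :=
  map (ren_letter p).

Definition occurs_word (c : name) (w : seq letter) : bool :=
  c \in map name_of w.

Inductive word_alpha_step : seq letter -> seq letter -> Prop :=
| WordAlphaStep w a b v u :
    abs_eq ren_word occurs_word a v b u ->
    word_alpha_step (w ++ Bar a :: v) (w ++ Bar b :: u).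

Definition word_alpha : seq letter -> seq letter -> Prop :=
  clos_refl_sym_trans (seq letter) word_alpha_step.

Record dfa (A : finType) : Type := Dfa {
  dfa_state : finType;
  dfa_start : dfa_state;
  dfa_final : {set dfa_state};
  dfa_step : dfa_state -> A -> dfa_state }.

Record nfa (A : finType) : Type := Nfa {
  nfa_state : finType;
  nfa_start : {set nfa_state};
  nfa_final : {set nfa_state};
  nfa_step : nfa_state -> A -> {set nfa_state} }.

Fixpoint nfa_accepts (A : finType) (N : nfa A) (q : nfa_state N) (w : seq A) :
    bool :=
  if w is a :: v then [exists p in nfa_step q a, nfa_accepts p v]
  else q \in nfa_final N.

Inductive word_aut (A : finType) : Type :=
| WordDfa of dfa A
| WordNfa of nfa A.

Definition word_lang (A : finType) (H : word_aut A) (w : seq A) : Prop :=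
  match H with
  | WordDfa D => foldl (@dfa_step A D) (dfa_start D) w \in dfa_final D
  | WordNfa N => [exists q in nfa_start N, nfa_accepts q w]
  end.

(** * Infinite words *)

Definition stream (A : Type) : Type := nat -> A.

Definition stream_map (A B : Type) (f : A -> B) (s : stream A) : stream B :=
  fun n => f (s n).

Definition omega_alpha (s t : stream letter) : Prop :=
  forall n : nat, word_alpha (mkseq s n) (mkseq t n).

(* The pair (u, v) with v nonempty; v is stored as its head and tail. *)
Record upword (A : Type) : Type := UPWord {
  up_stem : seq A;
  up_head : A;
  up_tail : seq A }.

Definition up_period (A : Type) (p : upword A) : seq A :=
  up_head p :: up_tail p.

Definition up_stream (A : Type) (p : upword A) : stream A := fun n =>
  if n < size (up_stem p) then nth (up_head p) (up_stem p) n
  else nth (up_head p) (up_period p)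
         ((n - size (up_stem p)) %% size (up_period p)).

Definition up_map (A B : Type) (f : A -> B) (p : upword A) : upword B :=
  UPWord (map f (up_stem p)) (f (up_head p)) (map f (up_tail p)).

Record buchi (A : finType) : Type := Buchi {
  buchi_state : finType;
  buchi_start : {set buchi_state};
  buchi_final : {set buchi_state};
  buchi_step : buchi_state -> A -> {set buchi_state} }.

Definition omega_lang (A : finType) (B : buchi A) (s : stream A) : Prop :=
  exists r : nat -> buchi_state B,
    [/\ r 0 \in buchi_start B,
        forall n, r n.+1 \in buchi_step (r n) (s n)
      & forall n, exists2 m, n <= m & r m \in buchi_final B].

(** * Trees *)

(* Trees over the signature X * Sig, where (x, f) has arity ar f. *)
Inductive tree (Sig : finType) (ar : Sig -> nat) (X : Type) : Type :=
| Node (x : X) (f : Sig) (ts : {ffun 'I_(ar f) -> tree ar X}).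

Fixpoint tree_map (Sig : finType) (ar : Sig -> nat) (X Y : Type) (h : X -> Y)
    (t : tree ar X) : tree ar Y :=
  let: Node x f ts := t in Node (h x) [ffun i => tree_map h (ts i)].

Definition ren_tree (Sig : finType) (ar : Sig -> nat) (p : name -> name) :
    tree ar letter -> tree ar letter :=
  tree_map (ren_letter p).

Fixpoint occurs_tree (Sig : finType) (ar : Sig -> nat) (c : name)
    (t : tree ar letter) : bool :=
  let: Node x f ts := t in
  (c == name_of x) || [exists i, occurs_tree c (ts i)].

Inductive tree_alpha (Sig : finType) (ar : Sig -> nat) :
    tree ar letter -> tree ar letter -> Prop :=
| TreeAlphaRefl t : tree_alpha t t
| TreeAlphaSym t u : tree_alpha t u -> tree_alpha u t
| TreeAlphaTrans t u v : tree_alpha t u -> tree_alpha u v -> tree_alpha t v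
| TreeAlphaCong x f (ts us : {ffun 'I_(ar f) -> tree ar letter}) :
    (forall i, tree_alpha (ts i) (us i)) ->
    tree_alpha (Node x ts) (Node x us)
| TreeAlphaBar a b f (ts us : {ffun 'I_(ar f) -> tree ar letter}) :
    (forall i, abs_eq (@ren_tree Sig ar) (@occurs_tree Sig ar)
                 a (ts i) b (us i)) ->
    tree_alpha (Node (Bar a) ts) (Node (Bar b) us).

Record dfta (Sig : finType) (ar : Sig -> nat) (A : finType) : Type := Dfta {
  dfta_state : finType;
  dfta_final : {set dfta_state};
  dfta_step : A -> forall f : Sig, {ffun 'I_(ar f) -> dfta_state} ->
              dfta_state }.

Record nfta (Sig : finType) (ar : Sig -> nat) (A : finType) : Type := Nfta {
  nfta_state : finType;
  nfta_final : {set nfta_state};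
  nfta_step : A -> forall f : Sig, {ffun 'I_(ar f) -> nfta_state} ->
              {set nfta_state} }.

Fixpoint dfta_eval (Sig : finType) (ar : Sig -> nat) (A : finType)
    (D : dfta ar A) (t : tree ar A) : dfta_state D :=
  let: Node x f ts := t in
  dfta_step x [ffun i => dfta_eval D (ts i)].

(* The set of states that some bottom-up run can assign to the root. *)
Fixpoint nfta_eval (Sig : finType) (ar : Sig -> nat) (A : finType)
    (N : nfta ar A) (t : tree ar A) : {set nfta_state N} :=
  let: Node x f ts := t in
  [set q | [exists qs : {ffun 'I_(ar f) -> nfta_state N},
              [forall i, qs i \in nfta_eval N (ts i)]
              && (q \in nfta_step x qs)]].

Inductive tree_aut (Sig : finType) (ar : Sig -> nat) (A : finType) : Type :=
| TreeDfta of dfta ar A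
| TreeNfta of nfta ar A.

Definition tree_lang (Sig : finType) (ar : Sig -> nat) (A : finType)
    (H : tree_aut ar A) (t : tree ar A) : Prop :=
  match H with
  | TreeDfta D => dfta_eval D t \in dfta_final D
  | TreeNfta N => [exists q in nfta_final N, q \in nfta_eval N t]
  end.

(** * Bar languages *)

Definition alpha_closed (X : Type) (alpha : X -> X -> Prop) (L : X -> Prop) :
    Prop :=
  forall x y, alpha x y -> L x -> L y.

(* X0 consists of the strings or trees over the finite alphabet, X of those over
   all letters; emb is the inclusion. *)
Definition bar_lang (X0 X Hyp : Type) (emb : X0 -> X) (alpha : X -> X -> Prop)
    (lang : Hyp -> X0 -> Prop) (H : Hyp) (x : X) : Prop :=
  exists2 y : X0, lang H y & alpha (emb y) x.

Definition restrict (X0 X : Type) (emb : X0 -> X) (L : X -> Prop) (y : X0) :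
    Prop :=
  L (emb y).

Definition word_emb (A0 : {fset letter}) : seq A0 -> seq letter := map val.

Definition omega_emb (A0 : {fset letter}) : stream A0 -> stream letter :=
  stream_map val.

Definition up_emb (A0 : {fset letter}) : upword A0 -> upword letter :=
  up_map val.

Definition tree_emb (Sig : finType) (ar : Sig -> nat) (A0 : {fset letter}) :
    tree ar A0 -> tree ar letter :=
  tree_map val.

Definition bar_word_lang (A0 : {fset letter}) :
    word_aut A0 -> seq letter -> Prop :=
  bar_lang (@word_emb A0) word_alpha (@word_lang A0).

Definition bar_omega_lang (A0 : {fset letter}) :
    buchi A0 -> stream letter -> Prop :=
  bar_lang (@omega_emb A0) omega_alpha (@omega_lang A0).

Definition bar_tree_lang (Sig : finType) (ar : Sig -> nat)
    (A0 : {fset letter}) : tree_aut ar A0 -> tree ar letter -> Prop :=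
  bar_lang (@tree_emb Sig ar A0) (@tree_alpha Sig ar) (@tree_lang Sig ar A0).

(** * MAT learning *)

Inductive query (I Hyp : Type) : Type :=
| Mem of I
| Equiv of Hyp.
Arguments Mem {I Hyp}.
Arguments Equiv {I Hyp}.

(* lr_mem is the reaction to the answer to a membership query, lr_cex the
   reaction to a counterexample.  A positive answer to an equivalence query ends
   the run, so no reaction to it is needed. *)
Record learner (I Hyp : Type) : Type := Learner {
  lr_state : Type;
  lr_start : lr_state;
  lr_query : lr_state -> query I Hyp;
  lr_mem : lr_state -> bool -> lr_state;
  lr_cex : lr_state -> I -> lr_state }.

(* Answers may depend on the interaction so far, through the state.  An
   equivalence query is answered by None (yes) or Some counterexample. *)
Record teacher (I Hyp : Type) : Type := Teacher {
  tc_state : Type;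
  tc_start : tc_state;
  tc_mem : tc_state -> I -> bool * tc_state;
  tc_equiv : tc_state -> Hyp -> option I * tc_state }.

(* Languages are predicates on X, and inputs denote elements of X via den; the
   two differ only for infinite words, where inputs are pairs (u, v). *)
Definition teaches (I X Hyp : Type) (den : I -> X) (lang : Hyp -> X -> Prop)
    (K : X -> Prop) (T : teacher I Hyp) : Prop :=
  (forall t w, (tc_mem (t : tc_state T) w).1 <-> K (den w)) /\
  (forall t H,
     match (tc_equiv (t : tc_state T) H).1 with
     | None => forall x, lang H x <-> K x
     | Some w => (lang H (den w) /\ ~ K (den w)) \/
                 (~ lang H (den w) /\ K (den w))
     end).

(* run s t m e H: from the states s and t, the interaction ends with the
   hypothesis H after m membership and e equivalence queries. *)
Inductive run (I Hyp : Type) (L : learner I Hyp) (T : teacher I Hyp) :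
    lr_state L -> tc_state T -> nat -> nat -> Hyp -> Prop :=
| RunMem s t w m e H :
    lr_query s = Mem w ->
    run (lr_mem s (tc_mem t w).1) (tc_mem t w).2 m e H ->
    run s t m.+1 e H
| RunCex s t G w m e H :
    lr_query s = Equiv G -> (tc_equiv t G).1 = Some w ->
    run (lr_cex s w) (tc_equiv t G).2 m e H ->
    run s t m e.+1 H
| RunYes s t H :
    lr_query s = Equiv H -> (tc_equiv t H).1 = None ->
    run s t 0 1 H.

(* None stands for infinity: many learners have no bound on their membership
   queries that is uniform in the counterexamples. *)
Definition within (n : nat) (B : option nat) : bool :=
  if B is Some b then n <= b else true.

Definition learns (I X Hyp : Type) (den : I -> X) (lang : Hyp -> X -> Prop)
    (L : learner I Hyp) (K : X -> Prop) (M E : option nat) : Prop :=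
  forall T : teacher I Hyp, teaches den lang K T ->
  exists m e H,
    [/\ run (lr_start L) (tc_start T) m e H,
        within m M, within e E & forall x, lang H x <-> K x].

(** * The learner for bar languages *)

(* I0 are the inputs over the finite alphabet, I those over all letters.  The
   state is left unchanged where no reaction is prescribed: if Step 1 fails, or
   if a counterexample arrives without an equivalence query. *)
Definition bar_learner (I0 I Hyp : Type) (emb : I0 -> I)
    (step1 : I -> option I0) (step2 : Hyp -> I0 -> option I0)
    (L : learner I0 Hyp) : learner I Hyp :=
  {| lr_state := lr_state L;
     lr_start := lr_start L;
     lr_query := fun s =>
       match lr_query s with Mem w => Mem (emb w) | Equiv H => Equiv H end;
     lr_mem := @lr_mem I0 Hyp L;
     lr_cex := fun s wT =>
       match lr_query s, step1 wT with
       | Equiv H, Some w => lr_cex s (odflt w (step2 H w))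
       | _, _ => s
       end |}.

(* eqv is alpha-equivalence of inputs. *)
Definition step1_correct (I0 I : Type) (emb : I0 -> I) (eqv : I -> I -> Prop)
    (step1 : I -> option I0) : Prop :=
  forall wT, (exists w, eqv (emb w) wT) ->
  exists2 w, step1 wT = Some w & eqv (emb w) wT.

Definition step2_correct (I0 I Hyp : Type) (emb : I0 -> I)
    (eqv : I -> I -> Prop) (accepts : Hyp -> I0 -> Prop)
    (step2 : Hyp -> I0 -> option I0) : Prop :=
  forall H w,
    match step2 H w with
    | Some w' => eqv (emb w') (emb w) /\ accepts H w'
    | None => ~ exists w', eqv (emb w') (emb w) /\ accepts H w'
    end.

Definition up_alpha (p q : upword letter) : Prop :=
  omega_alpha (up_stream p) (up_stream q).

Definition up_accepts (A : finType) (B : buchi A) (p : upword A) : Prop :=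
  omega_lang B (up_stream p).

(* Main.v *)
(* From a teacher T for the bar language L_T one builds a teacher for the literal
   language K = L_T restricted to A0, so that a run of L against it is a run of
   the bar learner against T.  A counterexample w_T of T becomes the word chosen
   by Steps 1 and 2: if w_T is wrongly accepted up to alpha, then so is an
   equivalent input literally, and Step 2 finds such an input; if w_T is missing,
   no equivalent input is accepted.  If T accepts a hypothesis H, the bar learner
   stops, so the internal teacher may continue with any correct answer.

   For infinite words these inputs, and the counterexamples in K \ L(H) when
   L_alpha(H) = L_T, must be ultimately periodic.  Alpha-equivalence over finitely
   many names is tracked by a finite amount of information (which names are bound
   at the same position), so Ramsey's theorem yields two positions between which
   the words, an accepting run and this information can be looped. *)
From mathcomp Require Import all_boot finmap zify.
From mathcomp.classical Require Import boolp.
From Stdlib Require Import Relation_Operators.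
Require Import Defs.

Set Implicit Arguments.
Unset Strict Implicit.
Unset Printing Implicit Defensive.

Lemma within_leq m n B : m <= n -> within n B -> within m B.
Proof. by case: B => [b|] //=; apply: leq_trans. Qed.

(** * Simulating the internal learner against the teacher for the bar language *)

Section Simulation.
Variables (I0 I X0 X Hyp : Type) (embI : I0 -> I) (emb : X0 -> X).
Variables (den0 : I0 -> X0) (den : I -> X) (alpha : X -> X -> Prop).
Variables (lang : Hyp -> X0 -> Prop) (LT : X -> Prop).
Variables (step1 : I -> option I0) (step2 : Hyp -> I0 -> option I0).
Let blang := bar_lang emb alpha lang.

Hypothesis den_emb : forall w, den (embI w) = emb (den0 w).
Hypothesis alpha_refl : forall x, alpha x x.
Hypothesis alpha_sym : forall x y, alpha x y -> alpha y x.
Hypothesis alpha_trans : forall x y z, alpha x y -> alpha y z -> alpha x z.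
Hypothesis LT_closed : alpha_closed alpha LT.
Hypothesis LT_regular : exists A, forall x, blang A x <-> LT x.
(** The next two facts supply counterexamples that are inputs. They are immediate for finite words
    and trees, where inputs are the elements themselves; infinite words need lassos. *)
Hypothesis blang_input : forall H p, blang H (den p) ->
  exists2 w, lang H (den0 w) & alpha (emb (den0 w)) (den p).
Hypothesis blang_diff_input : forall H y, blang H (emb y) -> ~ lang H y ->
  exists2 w, blang H (emb (den0 w)) & ~ lang H (den0 w).
Hypothesis step1P :
  step1_correct embI (fun p q => alpha (den p) (den q)) step1.
Hypothesis step2P :
  step2_correct embI (fun p q => alpha (den p) (den q))
    (fun H w => lang H (den0 w)) step2.

Let correct_answer H (o : option I0) :=
  match o with
  | None => forall x, lang H x <-> restrict emb LT x
  | Some w => (lang H (den0 w) /\ ~ restrict emb LT (den0 w)) \/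
              (~ lang H (den0 w) /\ restrict emb LT (den0 w))
  end.

Lemma lang_blang H y : lang H y -> blang H (emb y).
Proof. by exists y. Qed.

(** Since L(H) lies in its closure, a hypothesis with the right bar language can only miss elements,
    and [blang_diff_input] yields a missed input. For other H the claim is vacuous, so an answer can
    be chosen for every H. *)
Lemma exists_literal_answer H :
  exists o, (forall x, blang H x <-> LT x) -> correct_answer H o.
Proof.
have [HLT | nHLT] := pselect (forall x, blang H x <-> LT x);
  last by exists None.
have [[y /HLT yLT nyH] | no_diff] :=
  pselect (exists2 y, blang H (emb y) & ~ lang H y).
  have [w wH nwH] := blang_diff_input (proj2 (HLT _) yLT) nyH.
  by exists (Some w) => _; right; split=> //; apply/HLT.
exists None => _ x; split=> [/lang_blang/HLT // | /HLT xH].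
by apply: contrapT => nx; apply: no_diff; exists x.
Qed.

Section Teacher.
Variable T : teacher I Hyp.
Hypothesis T_teaches : teaches den blang LT T.
Variable literal_answer : Hyp -> option I0.
Hypothesis literal_answerP : forall H,
  (forall x, blang H x <-> LT x) -> correct_answer H (literal_answer H).

(* A hypothesis with the right bar language can still have too small a literal
   language.  The learner for bar languages stops there, but the internal run
   has to go on, so its teacher then answers on its own. *)
Definition internal_teacher : teacher I0 Hyp :=
  {| tc_state := tc_state T;
     tc_start := tc_start T;
     tc_mem := fun t w => tc_mem t (embI w);
     tc_equiv := fun t H =>
       match tc_equiv t H with
       | (Some wT, t') => (omap (fun w => odflt w (step2 H w)) (step1 wT), t')
       | (None, t') => (literal_answer H, t')
       end |}.

(** A counterexample lies in the bar language of H or in L_T; both come from automata over the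
    finite alphabet, so Step 1 has something to find. *)
Lemma step1_total t H wT : (tc_equiv (t : tc_state T) H).1 = Some wT ->
  exists2 w, step1 wT = Some w & alpha (emb (den0 w)) (den wT).
Proof.
move=> ans; have [_ /(_ t H)] := T_teaches; rewrite ans => cex.
have [G wTG] : exists G, blang G (den wT).
  case: cex => [[wTH _] | [_ wTLT]]; first by exists H.
  by have [A HA] := LT_regular; exists A; apply/HA.
have [w _ w_wT] := blang_input wTG.
have [|v -> v_wT] := step1P (wT := wT); first by exists w; rewrite den_emb.
by exists v; rewrite -?den_emb.
Qed.

Lemma internal_teacher_teaches :
  teaches den0 lang (restrict emb LT) internal_teacher.
Proof.
have [memP equivP] := T_teaches; split=> [t w | t H] /=.
  by rewrite memP /restrict den_emb.
move: (equivP t H) (@step1_total t H).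
case: (tc_equiv (t : tc_state T) H) => [[wT|] t'] /= cex;
  last by move=> _; apply: (literal_answerP cex).
case/(_ _ erefl) => w -> w_wT /=.
have LT_eq v : alpha (emb (den0 v)) (emb (den0 w)) ->
    LT (emb (den0 v)) <-> LT (den wT).
  move=> vw; have vwT := alpha_trans vw w_wT.
  by split; apply: LT_closed => //; apply: alpha_sym.
move: (step2P H w); case: (step2 H w) => [v|] /=.
  rewrite !den_emb => -[vw vH]; left; split=> //.
  rewrite /restrict LT_eq //.
  case: cex => [[] // | [nwT _]]; case: nwT.
  by exists (den0 v) => //; apply: alpha_trans vw w_wT.
move=> no_v; right.
have nwH : ~ lang H (den0 w) by move=> wH; apply: no_v; exists w; split.
split=> //; rewrite /restrict LT_eq //.
case: cex => [[/blang_input [v vH v_wT] _] | [] //]; case: no_v.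
exists v; split=> //; rewrite !den_emb.
by apply: alpha_trans v_wT _; apply: alpha_sym.
Qed.

(** Both runs go in lockstep until T accepts a hypothesis. The bar run stops there while the
    internal run may continue, whence the inequalities and the possibly different G. *)
Lemma run_bar_learner (L : learner I0 Hyp) s t m e H :
  @run _ _ L internal_teacher s t m e H ->
  exists m' e' G,
    [/\ @run _ _ (bar_learner embI step1 step2 L) T s t m' e' G,
        m' <= m, e' <= e & forall x, blang G x <-> LT x].
Proof.
have stops (G : Hyp) t0 : (tc_equiv (t0 : tc_state T) G).1 = None ->
    forall x, blang G x <-> LT x.
  by move=> ans; have [_ /(_ t0 G)] := T_teaches; rewrite ans.
elim=> {s t m e H} [s t w m e H q _ [m' [e' [G [IH le_m le_e GP]]]]
  | s t H w m e H' q ans _ [m' [e' [G [IH le_m le_e GP]]]] | s t H q ans].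
- exists m'.+1, e', G; split=> //; apply: (RunMem (w := embI w)) IH.
  by rewrite /= q.
- case ansT: (tc_equiv (t : tc_state T) H).1 => [wT|]; last first.
    exists 0, 1, H; split=> //; last exact: stops ansT.
    by apply: RunYes => //=; rewrite q.
  have [v step1E _] := step1_total ansT.
  exists m', e'.+1, G; split=> //; apply: (RunCex (G := H) (w := wT)) => //=.
    by rewrite q.
  rewrite q step1E; move: ans ansT IH => /=.
  by case: (tc_equiv (t : tc_state T) _) => [[a|] t'] //= + [aE];
      rewrite aE step1E => -[->].
(* The internal teacher says yes only if T does, as Step 1 never fails on a counterexample. *)
- case ansT: (tc_equiv (t : tc_state T) H).1 => [wT|].
    have [v step1E _] := step1_total ansT; move: ans ansT => /=.
    by case: (tc_equiv (t : tc_state T) _) => [[a|] t'] //= + [aE];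
      rewrite aE step1E.
  exists 0, 1, H; split=> //; last exact: stops ansT.
  by apply: RunYes => //=; rewrite q.
Qed.

End Teacher.

Lemma bar_learner_learns (L : learner I0 Hyp) (M E : option nat) :
  learns den0 lang L (restrict emb LT) M E ->
  learns den blang (bar_learner embI step1 step2 L) LT M E.
Proof.
move=> Llearns T T_teaches.
have [answer answerP] := choice exists_literal_answer.
have [m [e [H [Lrun mM eE _]]]] :=
  Llearns _ (internal_teacher_teaches T_teaches answerP).
have [m' [e' [G [Grun le_m le_e GP]]]] := run_bar_learner T_teaches Lrun.
by exists m', e', G; split=> //; [apply: within_leq mM | apply: within_leq eE].
Qed.

End Simulation.

(** * Alpha-equivalence of finite words by pairings of names *)

(* A pairing relates a name a of the first word to a name b of the second one if
   both were bound last at the same position, or both are still free and equal. *)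
Definition pairing := name -> name -> bool.

Definition free_pairing : pairing := fun a b => a == b.

(** The new pair shadows all older ones with a on the left or b on the right. Mixed letters never
    match, so keeping R for them is a mere default. *)
Definition pairing_step (R : pairing) (x y : letter) : pairing :=
  match x, y with
  | Bar a, Bar b => fun a' b' =>
      (a' == a) && (b' == b) || [&& a' != a, b' != b & R a' b']
  | _, _ => R
  end.

Definition letters_match (R : pairing) (x y : letter) : bool :=
  match x, y with
  | Plain a, Plain b => R a b
  | Bar _, Bar _ => true
  | _, _ => false
  end.

Fixpoint words_match (R : pairing) (v w : seq letter) : bool :=
  match v, w with
  | [::], [::] => true
  | x :: v', y :: w' =>
      letters_match R x y && words_match (pairing_step R x y) v' w'
  | _, _ => false
  end.

Lemma words_match_ren (p q : name -> name) (R S : pairing) v w :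
  injective p -> injective q ->
  (forall a b, occurs_word a v -> occurs_word b w -> R a b -> S (p a) (q b)) ->
  words_match R v w -> words_match S (ren_word p v) (ren_word q w).
Proof.
move=> pI qI; elim: v w R S => [|x v IH] [|y w] //= R S RS /andP[xy vw].
apply/andP; split.
  case: x y xy RS {vw} => a [] b //= Rab RS.
  by apply: RS => //; rewrite /occurs_word mem_head.
apply: IH vw => a b av bw.
have {}RS := RS a b (mem_behead (s := _ :: _) av) (mem_behead (s := _ :: _) bw).
case: x y {xy} RS => c [] d //= RS; rewrite !(inj_eq pI) !(inj_eq qI).
by case/orP => [-> // | /and3P[-> -> /RS ->]]; rewrite orbT.
Qed.

Lemma ren_word_id w : ren_word id w = w.
Proof. by rewrite /ren_word map_id_in // => -[]. Qed.

Lemma words_match_weaken (R S : pairing) v w :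
  (forall a b, R a b -> S a b) -> words_match R v w -> words_match S v w.
Proof.
move=> RS; rewrite -{2}(ren_word_id v) -{2}(ren_word_id w).
by apply: words_match_ren => // a b _ _; apply: RS.
Qed.

Lemma words_match_refl (R : pairing) w : (forall a, R a a) -> words_match R w w.
Proof.
elim: w R => //= x w IH R Rxx; apply/andP; split; first by case: x => /=.
by apply: IH => a; case: x => //= b; case: eqP => /=.
Qed.

Lemma words_match_sym (R S : pairing) v w :
  (forall a b, R a b -> S b a) -> words_match R v w -> words_match S w v.
Proof.
elim: v w R S => [|x v IH] [|y w] //= R S RS /andP[xy vw]; apply/andP; split.
  by case: x y xy {vw} => a [] b //=; apply: RS.
apply: IH vw => a b; case: x y xy => c [] d //= _; try exact: RS.
by case/orP => [/andP[-> ->] // | /and3P[-> -> /RS ->]]; rewrite orbT.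
Qed.

Lemma words_match_trans (R S T : pairing) u v w :
  (forall a b c, R a b -> S b c -> T a c) ->
  words_match R u v -> words_match S v w -> words_match T u w.
Proof.
elim: u v w R S T => [|x u IH] [|y v] [|z w] //= R S T RST.
move=> /andP[xy uv] /andP[yz vw]; apply/andP; split.
  by case: x y z xy yz {uv vw} => a [] b [] c //=; apply: RST.
apply: IH uv vw => a b c; case: x y z xy yz => a' [] b' [] c' //= _ _;
  try exact: RST.
case/orP => [/andP[-> /eqP->] | /and3P[-> /negPf-> Rab]].
  by rewrite eqxx /= orbF => ->.
by rewrite /= => /andP[-> /(RST _ _ _ Rab)->]; rewrite orbT.
Qed.

Lemma transpK a c : involutive (transp a c).
Proof.
move=> x; rewrite /transp; case: (eqVneq x a) => [->|xa].
  by case: eqVneq => //; rewrite eqxx.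
by case: (eqVneq x c) => [->|xc]; rewrite ?eqxx // (negPf xa) (negPf xc).
Qed.

Lemma transpR a c : transp a c c = a.
Proof. by rewrite /transp eqxx; case: eqP. Qed.

Lemma transp_inj a c : injective (transp a c).
Proof. exact: can_inj (transpK a c). Qed.

Lemma ren_word_transpK a c : involutive (ren_word (transp a c)).
Proof.
by move=> w; rewrite /ren_word -map_comp map_id_in // => -[] b _;
  rewrite /= transpK.
Qed.

Lemma occurs_ren_word p c w : injective p ->
  occurs_word (p c) (ren_word p w) = occurs_word c w.
Proof.
move=> pI; rewrite /occurs_word /ren_word -map_comp -[RHS](mem_map pI) -map_comp.
by congr (_ \in _); apply: eq_map => -[].
Qed.

(** Both bodies are renamings of the word obtained from v by (a c), which matches itself. Neither a
    nor b occurs in it, as c is fresh for v and u; its name c becomes the pair (a, b) and all other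
    names stay fixed. *)
Lemma word_alpha_step_match v w :
  word_alpha_step v w -> words_match free_pairing v w.
Proof.
case=> {v w} p a b v u [c [ca cb cv cu vuE]].
elim: p => [|x p IH] /=; last first.
  apply/andP; split; first by case: x => //= d; apply: eqxx.
  apply: words_match_weaken IH => a' b' /eqP ->.
  by case: x => d /=; [apply: eqxx | case: eqP => //= _; apply: eqxx].
rewrite -(ren_word_transpK a c v) -(ren_word_transpK b c u) -vuE.
apply: (@words_match_ren _ _ free_pairing); try exact: transp_inj; last first.
  by apply: words_match_refl => d; apply: eqxx.
move=> d _ dv _ /eqP <- /=.
have da : d != a.
  apply: contraNneq cv => da; rewrite -(occurs_ren_word _ _ (@transp_inj a c)).
  by rewrite transpR -{1}da.
have db : d != b.
  apply: contraNneq cu => db; rewrite -(occurs_ren_word _ _ (@transp_inj b c)).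
  by rewrite -vuE transpR -{1}db.
rewrite /transp (negPf da) (negPf db); case: (eqVneq d c) => _;
  first by rewrite !eqxx.
by rewrite da db /free_pairing eqxx orbT.
Qed.

Lemma word_alpha_match v w : word_alpha v w -> words_match free_pairing v w.
Proof.
elim=> {v w} [v w | v | v w _ | u v w _ uv _ vw].
- exact: word_alpha_step_match.
- by apply: words_match_refl => a; apply: eqxx.
- by apply: words_match_sym => a b /eqP ->; apply: eqxx.
- by apply: words_match_trans uv vw => a b c /eqP -> /eqP ->; apply: eqxx.
Qed.

Lemma word_alpha_cons x v w : word_alpha v w -> word_alpha (x :: v) (x :: w).
Proof.
elim=> {v w} [_ _ [p a b v u vu] | v | v w _ | u v w _ uv _ vw].
- by apply: rst_step; apply: (WordAlphaStep (x :: p)).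
- exact: rst_refl.
- exact: rst_sym.
- exact: rst_trans uv vw.
Qed.

Lemma exists_fresh (s : seq name) : exists c, c \notin s.
Proof.
exists (\max_(a <- s) a).+1; apply/negP => cs.
have := leq_bigmax_seq (P := xpredT) (F := id) _ cs isT.
by rewrite ltnn.
Qed.

Lemma word_alpha_fresh a c v : c != a -> ~~ occurs_word c v ->
  word_alpha (Bar a :: v) (Bar c :: ren_word (transp a c) v).
Proof.
move=> ca cv; apply: rst_step; apply: (WordAlphaStep [::]).
(* The witness of [abs_eq] must differ from both binders, so a second fresh name is needed besides
   c. *)
have [d] := exists_fresh
  [:: a, c & map name_of v ++ map name_of (ren_word (transp a c) v)].
rewrite !inE mem_cat !negb_or => /and4P[da dc dv dv']; exists d; split=> //.
rewrite /ren_word -map_comp; apply/eq_in_map => x xv.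
have xd : name_of x != d.
  by apply: contraNneq dv => <-; apply: map_f.
have xc : name_of x != c.
  by apply: contraNneq cv => <-; apply: map_f.
by case: x xd xc {xv} => b /= bd bc; congr (_ _); rewrite /transp;
  do ![case: eqP => //] => *; subst; rewrite ?eqxx in bd bc ca da dc *.
Qed.

(** Renaming both leading binders to one fresh c turns the pairing of the tails back into the free
    one. The renamed tails are not subwords, hence the induction on length. *)
Lemma words_match_alpha v w : words_match free_pairing v w -> word_alpha v w.
Proof.
have [n] := ubnP (size v); elim: n v w => // n IH [|x v] [|y w] //= sv.
  by move=> _; apply: rst_refl.
case: x y => a [] b //= => [/andP[/eqP-> vw] | vw].
  by apply: word_alpha_cons; apply: IH vw.
have [c] := exists_fresh [:: a, b & map name_of v ++ map name_of w].
rewrite !inE mem_cat !negb_or => /and4P[ca cb cv cw].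
apply: rst_trans (word_alpha_fresh ca cv) _.
apply: rst_trans _ (rst_sym _ _ _ _ (word_alpha_fresh cb cw)).
apply: word_alpha_cons; apply: IH; first by rewrite size_map.
apply: words_match_ren vw; try exact: transp_inj.
move=> a' b' av bw /orP[/andP[/eqP-> /eqP->] | /and3P[a'a b'b /eqP ab]].
  by rewrite /transp !eqxx; apply: eqxx.
have a'c : a' != c by apply: contraNneq cv => <-.
rewrite -ab in b'b *; rewrite /transp (negPf a'a) (negPf b'b) (negPf a'c).
exact: eqxx.
Qed.

(** * Alpha-equivalence of streams, position by position *)

Fixpoint stream_pairing (s t : stream letter) (n : nat) : pairing :=
  if n is m.+1 then pairing_step (stream_pairing s t m) (s m) (t m)
  else free_pairing.

Lemma words_match_rcons R v w x y : size v = size w ->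
  words_match R (rcons v x) (rcons w y) =
  words_match R v w && letters_match
    (foldl (fun R xy => pairing_step R xy.1 xy.2) R (zip v w)) x y.
Proof.
elim: v w R => [|a v IH] [|b w] R //= => [_ | [vw]]; first by rewrite andbT.
by rewrite IH // andbA.
Qed.

Lemma mkseqS (A : Type) (s : nat -> A) n :
  mkseq s n.+1 = rcons (mkseq s n) (s n).
Proof. by rewrite /mkseq -addn1 iotaD map_cat cats1. Qed.

(** The pairing at position n is the same in all longer prefixes, so the separate derivations for
    each prefix collapse into one local condition per position. *)
Lemma omega_alphaP (s t : stream letter) : omega_alpha s t <->
  forall n, letters_match (stream_pairing s t n) (s n) (t n).
Proof.
have pairingE n : foldl (fun R xy => pairing_step R xy.1 xy.2) free_pairing
    (zip (mkseq s n) (mkseq t n)) = stream_pairing s t n.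
  elim: n => // n IH; rewrite [RHS]/= -IH !mkseqS zip_rcons ?size_mkseq //.
  by rewrite foldl_rcons.
have step n : words_match free_pairing (mkseq s n.+1) (mkseq t n.+1) =
    words_match free_pairing (mkseq s n) (mkseq t n)
    && letters_match (stream_pairing s t n) (s n) (t n).
  by rewrite !mkseqS words_match_rcons ?size_mkseq // pairingE.
split=> [st n | st n]; last first.
  by apply: words_match_alpha; elim: n => // n IH; rewrite step IH st.
by have /word_alpha_match := st n.+1; rewrite step => /andP[].
Qed.

(** * Pigeonhole and Ramsey arguments on sets of positions *)

Lemma exists_uniform (C : finType) (Q : C -> nat -> Prop) :
  (forall c m n, m <= n -> Q c n -> Q c m) ->
  (forall n, exists c, Q c n) -> exists c, forall n, Q c n.
Proof.
move=> Qanti Qex; apply: contrapT => noc.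
have bad c : exists n, ~ Q c n.
  by apply/existsNP => Qc; apply: noc; exists c.
have [N NP] := choice bad.
have [c /(Qanti _ (N c)) Qc] := Qex (\max_c N c).
by apply: (NP c); apply: Qc; apply: leq_bigmax.
Qed.

Definition infinitely_often (P : nat -> Prop) : Prop :=
  forall n, exists2 m, n <= m & P m.

Lemma infinite_pigeonhole (C : finType) (h : nat -> C) P :
  infinitely_often P -> exists c, infinitely_often (fun n => P n /\ h n = c).
Proof.
move=> Pinf.
apply: (@exists_uniform C (fun c n => exists2 m, n <= m & P m /\ h m = c)).
  by move=> c m n mn [k nk Pk]; exists k => //; apply: leq_trans nk.
by move=> n; have [m nm Pm] := Pinf n; exists (h m), m.
Qed.

(* The decreasing infinite sets P n are chosen so that f n is constant, with value
   colour n, on P n.+1.  For a colour c that is unbounded on every P n, each term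
   is followed by some k in P n.+1 of colour c. *)
Lemma ramsey_consecutive (C : finType) (f : nat -> nat -> C) N :
  exists g c, [/\ N <= g 0, forall k, g k < g k.+1
    & forall k, f (g k) (g k.+1) = c].
Proof.
have pigeonhole (Pn : (nat -> Prop) * nat) : exists c, infinitely_often Pn.1 ->
    infinitely_often (fun m => Pn.1 m /\ f Pn.2 m = c).
  have [Pinf | nPinf] := pselect (infinitely_often Pn.1); last by exists (f 0 0).
  by have [c Pc] := infinite_pigeonhole (f Pn.2) Pinf; exists c.
have [pick pickP] := choice pigeonhole.
pose P := fix P n := if n is m.+1 then fun k => P m k /\ f m k = pick (P m, m)
                     else fun _ => True.
have Pinf n : infinitely_often (P n).
  by elim: n => [|n IH]; [move=> n; exists n | apply: pickP (P n, n) IH].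
have Panti m n k : m <= n -> P n k -> P m k.
  elim: n => [|n IH]; first by case: m.
  by rewrite leq_eqVlt => /predU1P[-> // | /IH Pmn [/Pmn]].
pose colour n := pick (P n, n).
have [c cP] : exists c, forall n,
    infinitely_often (fun k => P n k /\ colour k = c).
  apply: exists_uniform => [c m n mn Pc k | n].
    by have [l kl [Pl lc]] := Pc k; exists l => //; split=> //; apply: Panti Pl.
  exact: infinite_pigeonhole.
have nextP n : exists k, [/\ n < k, P n.+1 k & colour k = c].
  by have [k nk [Pk kc]] := cP n.+1 n.+1; exists k.
have [next {}nextP] := choice nextP.
have iterP k : colour (iter k.+1 next N) = c by have [] := nextP (iter k next N).
(* The sequence starts at [next N], because N itself need not have colour c. *)
exists (fun k => iter k.+1 next N), c; split=> [|k|k].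
- by have [/ltnW] := nextP N.
- by have [] := nextP (iter k.+1 next N).
- by have [_ [_ ->] _] := nextP (iter k.+1 next N); apply: iterP.
Qed.

(** * Lassos: looping streams, pairings and runs *)

(* The n-th position on the path that runs through [0, j) and then repeats [i, j). *)
Definition lasso_index (i j n : nat) : nat :=
  if n < i then n else i + (n - i) %% (j - i).

Lemma lasso_index_lt i j n : i < j -> n < j -> lasso_index i j n = n.
Proof.
move=> ij nj; rewrite /lasso_index; case: ltnP => // ni.
by rewrite modn_small ?subnKC // ltn_sub2r.
Qed.

Lemma lasso_index_period i j k n : n < j - i ->
  lasso_index i j (i + k * (j - i) + n) = i + n.
Proof.
move=> nj; rewrite /lasso_index -addnA ltnNge leq_addr /= addKn.
by rewrite modnMDl modn_small.
Qed.

Lemma lasso_indexS i j n : i < j ->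
  lasso_index i j n.+1 =
  if (lasso_index i j n).+1 == j then i else (lasso_index i j n).+1.
Proof.
move=> ij; rewrite /lasso_index; case: (ltnP n i) => ni.
  rewrite (ltn_eqF (leq_ltn_trans ni ij)); case: ltnP => // ni'.
  have -> : n.+1 = i by apply/eqP; rewrite eqn_leq ni ni'.
  by rewrite subnn mod0n addn0.
rewrite ltnNge leqW //= subSn //.
have lt_mod : (n - i) %% (j - i) < j - i by rewrite ltn_pmod ?subn_gt0.
rewrite [in LHS](divn_eq (n - i) (j - i)) -addnS modnMDl.
have -> k : ((i + k).+1 == j) = (k.+1 == j - i).
  by rewrite -[RHS](eqn_add2l i) subnKC ?(ltnW ij) // addnS.
case: eqP => [-> | /eqP neq]; first by rewrite modnn addn0.
by rewrite modn_small ?addnS // ltn_neqAle neq.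
Qed.

Definition lasso (A : Type) (s : stream A) (i j : nat) : upword A :=
  UPWord (mkseq s i) (s i) (mkseq (fun n => s (i + n.+1)) (j - i).-1).

Lemma up_stream_lasso (A : Type) (s : stream A) i j : i < j ->
  up_stream (lasso s i j) = s \o lasso_index i j.
Proof.
move=> ij; apply: funext => n; rewrite /up_stream /lasso_index /=.
rewrite !size_mkseq prednK ?subn_gt0 //; case: ltnP => ni.
  by rewrite nth_mkseq.
have := ltn_pmod (n - i) (_ : 0 < j - i); rewrite subn_gt0 => /(_ ij).
case: (_ %% _) => [|m] mj /=; first by rewrite addn0.
by rewrite nth_mkseq // -ltnS prednK // subn_gt0.
Qed.

(** Keeps a given periodic word unchanged while an equivalent stream is looped: the loop consists of
    whole periods. *)
Lemma up_stream_lasso_index (A : Type) (p : upword A) i j :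
  size (up_stem p) <= i -> i < j -> i = j %[mod size (up_period p)] ->
  up_stream p \o lasso_index i j = up_stream p.
Proof.
move=> pi ij ijp; apply: funext => n /=; rewrite /lasso_index.
case: ltnP => // ni; rewrite /up_stream.
rewrite !ltnNge (leq_trans pi ni) (leq_trans pi (leq_addr _ _)) /=.
congr nth; rewrite -addnBAC // -modnDmr modn_dvdm.
  by rewrite modnDmr addnBAC // addnC subnK.
by rewrite -eqn_mod_dvd ?(ltnW ij) // ijp.
Qed.

(** The value of [pairing_step] at (a, b) depends on the old pairing only at (a, b), so agreement on
    the finitely many pairs below N is enough. *)
Lemma stream_pairing_lasso (s t : stream letter) i j N : i < j ->
  (forall a b, a < N -> b < N ->
     stream_pairing s t i a b = stream_pairing s t j a b) ->
  forall n a b, a < N -> b < N ->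
    stream_pairing (s \o lasso_index i j) (t \o lasso_index i j) n a b =
    stream_pairing s t (lasso_index i j n) a b.
Proof.
move=> ij st_ij; elim=> [|n IH] a b aN bN.
  by rewrite lasso_index_lt //; apply: leq_ltn_trans ij.
set m := lasso_index i j n in IH *.
have -> : stream_pairing s t (lasso_index i j n.+1) a b =
    stream_pairing s t m.+1 a b.
  by rewrite lasso_indexS //; case: eqP => // mj; rewrite st_ij // -mj.
rewrite /= -/m; case: (s m) (t m) => a' [] b' //=; rewrite ?IH //.
Qed.

Lemma omega_alpha_lasso (s t : stream letter) i j N : i < j ->
  (forall n, name_of (s n) < N) -> (forall n, name_of (t n) < N) ->
  (forall a b, a < N -> b < N ->
     stream_pairing s t i a b = stream_pairing s t j a b) ->
  omega_alpha s t ->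
  omega_alpha (s \o lasso_index i j) (t \o lasso_index i j).
Proof.
move=> ij sN tN st_ij /omega_alphaP st; apply/omega_alphaP => n.
move: (st (lasso_index i j n)).
move: (sN (lasso_index i j n)) (tN (lasso_index i j n)) => /=.
case: (s _) (t _) => a [] b //= aN bN.
by rewrite (stream_pairing_lasso ij st_ij).
Qed.

Definition buchi_run (A : finType) (B : buchi A) (s : stream A)
    (r : nat -> buchi_state B) : Prop :=
  r 0 \in buchi_start B /\ forall n, r n.+1 \in buchi_step (r n) (s n).

Lemma omega_lang_lasso (A : finType) (B : buchi A) (s : stream A)
    (r : nat -> buchi_state B) i j m :
  buchi_run s r -> r i = r j -> i <= m < j -> r m \in buchi_final B ->
  omega_lang B (s \o lasso_index i j).
Proof.
move=> [r0 rS] rij /andP[im mj] rm; have ij := leq_ltn_trans im mj.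
exists (r \o lasso_index i j); split=> [|n|n] /=.
- by rewrite lasso_index_lt //; apply: leq_ltn_trans ij.
- rewrite lasso_indexS //; case: eqP => [jE|_]; last exact: rS.
  by rewrite rij; have := rS (lasso_index i j n); rewrite jE.
(* The visit to m in turn n of the loop; each turn has at least one letter. *)
- exists (i + n * (j - i) + (m - i)); first by nia.
  by rewrite lasso_index_period ?subnKC //; lia.
Qed.

(** * Replacing the blocks of a stream accepted by a Büchi automaton *)

Lemma increasing_leq (g : nat -> nat) m n :
  (forall k, g k < g k.+1) -> m <= n -> g m <= g n.
Proof.
move=> gS; elim: n => [|n IH]; first by case: m.
rewrite leq_eqVlt => /predU1P[-> // | /IH gmn].
exact: leq_trans gmn (ltnW (gS n)).
Qed.

Lemma increasing_ge (g : nat -> nat) n : (forall k, g k < g k.+1) -> n <= g n.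
Proof. by move=> gS; elim: n => // n IH; apply: leq_ltn_trans IH (gS n). Qed.

Lemma exists_block (g : nat -> nat) n : (forall k, g k < g k.+1) -> g 0 <= n ->
  exists k, g k <= n < g k.+1.
Proof.
move=> gS; elim: n => [|n IH] g0n.
  by exists 0; rewrite g0n (leq_ltn_trans _ (gS 0)).
move: g0n; rewrite leq_eqVlt => /predU1P[<- | /IH [k /andP[kn nk]]].
  by exists 0; rewrite leqnn gS.
have [nSk | kSn] := ltnP n.+1 (g k.+1).
  by exists k; rewrite nSk leqW.
by exists k.+1; rewrite kSn (leq_ltn_trans nk (gS _)).
Qed.

Lemma block_unique (g : nat -> nat) k l n : (forall k, g k < g k.+1) ->
  g k <= n < g k.+1 -> g l <= n < g l.+1 -> k = l.
Proof.
move=> gS /andP[kn nk] /andP[ln nl].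
have [kl | lk | //] := ltngtP k l.
  by have := leq_trans (increasing_leq gS kl) ln; rewrite leqNgt nk.
by have := leq_trans (increasing_leq gS lk) kn; rewrite leqNgt nl.
Qed.

Section Segments.
Variables (A : finType) (B : buchi A).

Definition segment_run (s : stream A) (i l : nat) (q q' : buchi_state B)
    (b : bool) : Prop :=
  exists r : nat -> buchi_state B,
    [/\ r 0 = q, r l = q', forall n, n < l ->
        r n.+1 \in buchi_step (r n) (s (i + n))
      & b -> exists2 n, n < l & r n \in buchi_final B].

Lemma segment_run_ext s s' i i' l q q' b :
  (forall n, n < l -> s (i + n) = s' (i' + n)) ->
  segment_run s i l q q' b -> segment_run s' i' l q q' b.
Proof.
move=> ss' [r [r0 rl rS rb]]; exists r; split=> // n nl.
by rewrite -ss' //; apply: rS.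
Qed.

(** The Büchi congruence class of the segment, with finitely many values, so that it can serve as a
    Ramsey colour. *)
Definition profile (s : stream A) (i j : nat) :
    {ffun buchi_state B * buchi_state B * bool -> bool} :=
  [ffun x => `[< segment_run s i (j - i) x.1.1 x.1.2 x.2 >]].

Lemma segment_run_profile s i j i' j' q q' b : profile s i j = profile s i' j' ->
  segment_run s i (j - i) q q' b -> segment_run s i' (j' - i') q q' b.
Proof.
by move=> /ffunP /(_ (q, q', b)); rewrite !ffunE /= => E /asboolP;
  rewrite E => /asboolP.
Qed.

Lemma omega_lang_segments (s t : stream A) (g h : nat -> nat) :
  g 0 = 0 -> h 0 = 0 -> (forall k, g k < g k.+1) -> (forall k, h k < h k.+1) ->
  (forall k q q' b, segment_run s (g k) (g k.+1 - g k) q q' b ->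
                    segment_run t (h k) (h k.+1 - h k) q q' b) ->
  omega_lang B s -> omega_lang B t.
Proof.
move=> g0 h0 gS hS st [r [r0 rS rF]].
pose b k := `[< exists2 m, g k <= m < g k.+1 & r m \in buchi_final B >].
have segs k : segment_run t (h k) (h k.+1 - h k) (r (g k)) (r (g k.+1)) (b k).
  apply: st; exists (fun n => r (g k + n)).
  split=> [||n _|/asboolP[m /andP[km mk] mF]].
  - by rewrite addn0.
  - by rewrite subnKC // ltnW.
  - by rewrite addnS.
  - by exists (m - g k); rewrite ?subnKC // ltn_sub2r.
have [rho rhoP] := choice segs.
have [block blockP] := choice (fun n => exists_block (n := n) hS
  (leq_trans (eq_leq h0) (leq0n n))).
pose r' n := rho (block n) (n - h (block n)).
(* This includes the right end [h k.+1], where [r'] already follows the next piece: both pieces are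
   in state [r (g k.+1)] there. *)
have r'E k n : h k <= n <= h k.+1 -> r' n = rho k (n - h k).
  move=> /andP[kn]; rewrite leq_eqVlt => /predU1P[-> | nk].
    have bE : block (h k.+1) = k.+1.
      by apply: (block_unique hS (blockP _)); rewrite leqnn hS.
    rewrite /r' bE subnn; have [-> _ _ _] := rhoP k.+1.
    by have [_ -> _ _] := rhoP k.
  have -> // : k = block n by apply: (block_unique hS _ (blockP n));
    rewrite kn nk.
exists r'; split=> [|n|n].
- rewrite (r'E 0) h0 ?leq0n //; have [-> _ _ _] := rhoP 0.
  by rewrite g0.
- have /andP[kn nk] := blockP n; have [_ _ step _] := rhoP (block n).
  rewrite (r'E (block n) n) ?kn ?(ltnW nk) // (r'E (block n) n.+1) ?leqW //.
  rewrite subSn //; have := step (n - h (block n)); rewrite subnKC //.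
  by apply; apply: ltn_sub2r => //; apply: hS.
- have [m nm mF] := rF (g n).
  have [k /andP[km mk]] :=
    exists_block (n := m) gS (leq_trans (eq_leq g0) (leq0n m)).
  have bk : b k by apply/asboolP; exists m => //; rewrite km.
  have [_ _ _ /(_ bk) [l lk lF]] := rhoP k.
  exists (h k + l); last by rewrite (r'E k) ?addKn // leq_addr /=; lia.
  have nk : n <= k.
    rewrite leqNgt; apply/negP => kn.
    by have := leq_trans (increasing_leq gS kn) nm; rewrite leqNgt mk.
  by apply: leq_trans nk (leq_trans (increasing_ge _ hS) (leq_addr _ _)).
Qed.

End Segments.

(** * Reduction to ultimately periodic words *)

Lemma exists_name_bound (s : seq letter) :
  exists N, {in s, forall x, name_of x < N}.
Proof.
exists (\max_(x <- s) name_of x).+1 => x xs.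
by rewrite ltnS (leq_bigmax_seq (P := xpredT)).
Qed.

Lemma up_stream_mem (p : upword letter) n :
  up_stream p n \in up_stem p ++ up_period p.
Proof.
rewrite mem_cat /up_stream; case: ltnP => pn; first by rewrite mem_nth.
by rewrite [X in _ || X]mem_nth ?orbT // ltn_pmod.
Qed.

Lemma omega_emb_mem (A0 : {fset letter}) (s : stream A0) n :
  omega_emb s n \in codom (val : A0 -> letter).
Proof. exact: codom_f. Qed.

(** The Ramsey colour records what a loop must preserve: the run state, the pairing on names below
    N, and whether a final state is visited in between; f adds what the application needs. *)
Lemma exists_lasso_positions (A : finType) (B : buchi A) (u : stream A)
    (s t : stream letter) (S : seq letter) (C : finType) (f : nat -> nat -> C) K :
  (forall n, s n \in S) -> (forall n, t n \in S) ->
  omega_alpha s t -> omega_lang B u ->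
  exists g : nat -> nat,
    [/\ K <= g 0, forall k, g k < g k.+1,
        forall k, f (g k) (g k.+1) = f (g 0) (g 1),
        omega_alpha (s \o lasso_index (g 0) (g 1)) (t \o lasso_index (g 0) (g 1))
      & omega_lang B (u \o lasso_index (g 0) (g 1))].
Proof.
move=> sS tS st [r [r0 rS rF]]; have [N SN] := exists_name_bound S.
pose colour i j := (f i j, r i,
  [ffun ab : 'I_N * 'I_N => stream_pairing s t i ab.1 ab.2],
  [exists m : 'I_j, (i <= m) && (r m \in buchi_final B)]).
have [g [c [Kg gS gc]]] := ramsey_consecutive colour K.
have colourE k : colour (g k) (g k.+1) = colour (g 0) (g 1) by rewrite !gc.
exists g; split=> // [k||].
- by have [] := colourE k.
- apply: (omega_alpha_lasso (N := N)) => // [n|n|a b aN bN].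
  + exact: SN.
  + exact: SN.
  + have [_ _ /ffunP /(_ (Ordinal aN, Ordinal bN))] := colourE 1.
    by rewrite !ffunE.
(* Some block contains a final state, and all blocks have one colour, so the first block contains
   one too. *)
- have [m g0m mF] := rF (g 0).
  have [k /andP[km mk]] := exists_block gS g0m.
  have [_ _ _ visitE] := colourE k.
  have : [exists m : 'I_(g k.+1), (g k <= m) && (r m \in buchi_final B)].
    by apply/existsP; exists (Ordinal mk); rewrite /= km.
  rewrite visitE => /existsP[l /andP[l0 lF]].
  apply: (omega_lang_lasso (r := r) (m := l)) => //; last by rewrite l0 ltn_ord.
  by have [_ ->] := colourE 1.
Qed.

(** With f the phase in the period of p and K the length of its stem, looping leaves p unchanged and
    makes the accepted z periodic. *)
Lemma bar_omega_lang_up (A0 : {fset letter}) (B : buchi A0) (p : upword letter) :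
  bar_omega_lang B (up_stream p) ->
  exists2 w : upword A0, omega_lang B (up_stream w)
    & omega_alpha (omega_emb (up_stream w)) (up_stream p).
Proof.
move=> [z zB zp].
pose S := codom (val : A0 -> letter) ++ up_stem p ++ up_period p.
pose phase i (_ : nat) :=
  inord (i %% size (up_period p)) : 'I_(size (up_period p)).
have [||g [Kg gS phaseE zp' zB']] := exists_lasso_positions (S := S) phase
    (size (up_stem p)) _ _ zp zB.
- by move=> n; rewrite mem_cat omega_emb_mem.
- by move=> n; rewrite mem_cat up_stream_mem orbT.
exists (lasso z (g 0) (g 1)); rewrite up_stream_lasso //.
rewrite -(up_stream_lasso_index Kg (gS 0)) //.
by have /(congr1 (@nat_of_ord _)) := phaseE 1; rewrite /phase !inordK ?ltn_pmod.
Qed.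

(** Loop y together with an equivalent accepted z. Blocks of y have equal profiles, so if the looped
    y were accepted, y would be too. *)
Lemma bar_omega_lang_diff_up (A0 : {fset letter}) (B : buchi A0) (y : stream A0) :
  bar_omega_lang B (omega_emb y) -> ~ omega_lang B y ->
  exists2 w : upword A0, bar_omega_lang B (omega_emb (up_stream w))
    & ~ omega_lang B (up_stream w).
Proof.
move=> [z zB zy] nyB.
(* The bound 1 makes [g 0] positive, so that the initial segment before the loop is nonempty. *)
have [||g [g0 gS profileE zy' zB']] :=
  exists_lasso_positions (S := codom (val : A0 -> letter))
    (profile B y) 1 _ _ zy zB.
- by move=> n; apply: omega_emb_mem.
- by move=> n; apply: omega_emb_mem.
have g01 := gS 0.
exists (lasso y (g 0) (g 1)); rewrite up_stream_lasso //.
  by exists (z \o lasso_index (g 0) (g 1)).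
(* The k-th turn around the loop is replaced by the k-th block of y, which has
   the same profile. *)
move=> yB; apply: nyB.
pose G k := if k is k'.+1 then g k' else 0.
pose T k := if k is k'.+1 then g 0 + k' * (g 1 - g 0) else 0.
apply: (@omega_lang_segments _ B _ _ T G) yB => // [[|k]|[|k]|[|k] q q' b].
- by rewrite /T mul0n addn0.
- by rewrite /T ltn_add2l ltn_mul2r subn_gt0 g01 ltnSn.
- by [].
- exact: gS.
- rewrite /T /G mul0n !addn0 subn0; apply: segment_run_ext => n ng /=.
  by rewrite lasso_index_lt // (ltn_trans ng).
- rewrite /T /G subnDl mulSn addnK => loop.
  apply: segment_run_profile (esym (profileE k)) _.
  by apply: segment_run_ext loop => n ng /=; rewrite lasso_index_period.
Qed.

(** * Instances for words, infinite words and trees *)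

Lemma up_stream_map (A B : Type) (f : A -> B) (p : upword A) :
  up_stream (up_map f p) = stream_map f (up_stream p).
Proof.
apply: funext => n; rewrite /up_stream /stream_map /up_period /= !size_map.
case: ltnP => pn; first by rewrite (nth_map (up_head p)).
by rewrite -map_cons (nth_map (up_head p)) // ltn_pmod.
Qed.

Theorem theorem5p2 :
  (forall (A0 : {fset letter}) (LT : seq letter -> Prop),
     alpha_closed word_alpha LT ->
     (exists A : word_aut A0, forall x, bar_word_lang A x <-> LT x) ->
   forall (L : learner (seq A0) (word_aut A0)) (M E : option nat),
     learns id (@word_lang A0) L (restrict (@word_emb A0) LT) M E ->
   forall (step1 : seq letter -> option (seq A0))
          (step2 : word_aut A0 -> seq A0 -> option (seq A0)),
     step1_correct (@word_emb A0) word_alpha step1 ->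
     step2_correct (@word_emb A0) word_alpha (@word_lang A0) step2 ->
   learns id (@bar_word_lang A0) (bar_learner (@word_emb A0) step1 step2 L)
     LT M E)
  /\
  (forall (A0 : {fset letter}) (LT : stream letter -> Prop),
     alpha_closed omega_alpha LT ->
     (exists A : buchi A0, forall x, bar_omega_lang A x <-> LT x) ->
   forall (L : learner (upword A0) (buchi A0)) (M E : option nat),
     learns (@up_stream A0) (@omega_lang A0) L
       (restrict (@omega_emb A0) LT) M E ->
   forall (step1 : upword letter -> option (upword A0))
          (step2 : buchi A0 -> upword A0 -> option (upword A0)),
     step1_correct (@up_emb A0) up_alpha step1 ->
     step2_correct (@up_emb A0) up_alpha (@up_accepts A0) step2 ->
   learns (@up_stream letter) (@bar_omega_lang A0)
     (bar_learner (@up_emb A0) step1 step2 L) LT M E)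
  /\
  (forall (Sig : finType) (ar : Sig -> nat) (A0 : {fset letter})
          (LT : tree ar letter -> Prop),
     alpha_closed (@tree_alpha Sig ar) LT ->
     (exists A : tree_aut ar A0, forall x, bar_tree_lang A x <-> LT x) ->
   forall (L : learner (tree ar A0) (tree_aut ar A0)) (M E : option nat),
     learns id (@tree_lang Sig ar A0) L (restrict (@tree_emb Sig ar A0) LT) M E ->
   forall (step1 : tree ar letter -> option (tree ar A0))
          (step2 : tree_aut ar A0 -> tree ar A0 -> option (tree ar A0)),
     step1_correct (@tree_emb Sig ar A0) (@tree_alpha Sig ar) step1 ->
     step2_correct (@tree_emb Sig ar A0) (@tree_alpha Sig ar)
       (@tree_lang Sig ar A0) step2 ->
   learns id (@bar_tree_lang Sig ar A0)
     (bar_learner (@tree_emb Sig ar A0) step1 step2 L) LT M E).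
Proof.
split; last split.
- move=> A0 LT LTc LTr L M E learnsL step1 step2 s1 s2.
  apply: (bar_learner_learns (den0 := id)) => //.
  + exact: rst_refl.
  + exact: rst_sym.
  + exact: rst_trans.
  + by move=> H y yH nyH; exists y.
- move=> A0 LT LTc LTr L M E learnsL step1 step2 s1 s2.
  apply: bar_learner_learns => //.
  + exact: up_stream_map.
  + by move=> s n; apply: rst_refl.
  + by move=> s t st n; apply/rst_sym/st.
  + by move=> s t u st tu n; exact: rst_trans (st n) (tu n).
  + exact: bar_omega_lang_up.
  + exact: bar_omega_lang_diff_up.
  + exact: s2.
  + exact: learnsL.
- move=> Sig ar A0 LT LTc LTr L M E learnsL step1 step2 s1 s2.
  apply: (bar_learner_learns (den0 := id)) => //.
  + exact: TreeAlphaRefl.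
  + exact: TreeAlphaSym.
  + exact: TreeAlphaTrans.
  + by move=> H y yH nyH; exists y.
Qed.
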